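(* Let $m\ge 3$ be an integer. The $2$-binomial complexity $b_{\mathbf{t}_m,2}$ of the generalized Thue-Morse word $\mathbf{t}_m$ is ultimately periodic with period $m^2$; that is, there is an integer $N$ such that $b_{\mathbf{t}_m,2}(n+m^2)=b_{\mathbf{t}_m,2}(n)$ for all $n\ge N$.
   Context: Let $\Sigma_m=\{0,1,\dots,m-1\}$ and let $\Sigma_m^*$ be the set of finite words over $\Sigma_m$. The morphism $\sigma_m:\Sigma_m^*\to\Sigma_m^*$ is defined on letters by $\sigma_m(a)=a(a+1)\cdots(a+m-1)$, each letter reduced modulo $m$ to an element of $\Sigma_m$. The generalized Thue-Morse word $\mathbf{t}_m=\sigma_m^\infty(0)$ is the infinite fixed point of $\sigma_m$ beginning with $0$. For $n\ge1$, $\mathcal{F}_{\mathbf{t}_m}(n)$ is the set of factors (blocks of consecutive letters) of $\mathbf{t}_m$ of length $n$. For finite words $u,x$, $\binom{u}{x}$ is the number of occurrences of $x$ as a (not necessarily contiguous) subsequence of $u$. Two words satisfy $u\sim_2 v$ if $\binom{u}{x}=\binom{v}{x}$ for all words $x\in\Sigma_m^*$ of length at most $2$. The $2$-binomial complexity is $b_{\mathbf{t}_m,2}(n)=\#(\mathcal{F}_{\mathbf{t}_m}(n)/\!\sim_2)$, the number of $\sim_2$-classes of factors of length $n$. *)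

(* Defs.v *)
From mathcomp Require Import all_boot all_algebra.
From mathcomp Require Import boolp.

Set Implicit Arguments.
Unset Strict Implicit.
Unset Printing Implicit Defensive.

Import GRing.Theory.

(* A mask of length [size u] is a choice of positions in [u], so each
   occurrence of [x] in [u] as a subsequence is counted exactly once. *)
Definition binom_word (T : eqType) (u x : seq T) : nat :=
  #|[set s : (size u).-tuple bool | mask s u == x]|.

Definition binom_equiv (T : eqType) (k : nat) (u v : seq T) : Prop :=
  forall x : seq T, size x <= k -> binom_word u x = binom_word v x.

Definition factor_at (T : Type) (w : nat -> T) (n i : nat) : n.-tuple T :=
  [tuple w (i + j) | j < n].

Definition factors (T : finType) (w : nat -> T) (n : nat) : {set n.-tuple T} :=
  [set u | `[< exists i, u = factor_at w n i >]].

Definition binom_complexity (T : finType) (w : nat -> T) (k n : nat) : nat :=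
  #|equivalence_partition
      (fun u v : n.-tuple T => `[< binom_equiv k u v >]) (factors w n)|.

(* The alphabet {0, ..., m-1} is ['Z_m], whose addition is addition modulo m;
   this is the intended alphabet only when [1 < m]. *)
Definition sigma_letter (m : nat) (a : 'Z_m) : seq 'Z_m :=
  [seq (a + i%:R)%R | i <- iota 0 m].

Definition sigma (m : nat) (u : seq 'Z_m) : seq 'Z_m :=
  flatten [seq sigma_letter a | a <- u].

(* For [1 < m] the words sigma^k(0) have length m ^ k > k and each is a prefix
   of the next, so the k-th letter of their limit can be read off sigma^k(0);
   see [thue_morse_prefix] and [thue_morse_fixpoint]. *)
Definition thue_morse (m : nat) (k : nat) : 'Z_m :=
  nth 0%R (iter k (@sigma m) [:: 0%R]) k.

Lemma sigma_cat m (u v : seq 'Z_m) : sigma (u ++ v) = sigma u ++ sigma v.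
Proof. by rewrite /sigma map_cat flatten_cat. Qed.

Lemma size_sigma m (u : seq 'Z_m) : size (sigma u) = m * size u.
Proof.
elim: u => [|a u IHu]; first by rewrite muln0.
by rewrite [sigma _]/= size_cat IHu size_map size_iota mulnS.
Qed.

Lemma size_iter_sigma m k : size (iter k (@sigma m) [:: 0%R]) = m ^ k.
Proof. by elim: k => //= k IHk; rewrite size_sigma IHk expnS. Qed.

Lemma prefix_sigma m (u v : seq 'Z_m) :
  prefix u v -> prefix (sigma u) (sigma v).
Proof. by case/prefixP=> w ->; rewrite sigma_cat prefix_prefix. Qed.

Lemma prefix_iter_sigma m k l : 1 < m -> k <= l ->
  prefix (iter k (@sigma m) [:: 0%R]) (iter l (@sigma m) [:: 0%R]).
Proof.
move=> m_gt1 /subnKC <-; elim: (l - k) => [|d IHd].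
  by rewrite addn0 prefix_refl.
apply: prefix_trans IHd _; rewrite addnS iterSr.
elim: (k + d) => [|e IHe] /=; last exact: prefix_sigma.
case: m m_gt1 => // m _.
by rewrite /sigma /sigma_letter /= prefix0s.
Qed.

Lemma thue_morse_prefix m k : 1 < m ->
  mkseq (thue_morse m) (m ^ k) = iter k (@sigma m) [:: 0%R].
Proof.
move=> m_gt1; apply: (@eq_from_nth _ 0%R).
  by rewrite size_mkseq size_iter_sigma.
move=> i; rewrite size_mkseq => lt_i; rewrite nth_mkseq // /thue_morse.
have lt_ii : i < m ^ i by apply: ltn_expl.
have [le_ik | /ltnW le_ki] := leqP i k.
  have /prefixP[w ->] := prefix_iter_sigma m_gt1 le_ik.
  by rewrite nth_cat size_iter_sigma lt_ii.
have /prefixP[w ->] := prefix_iter_sigma m_gt1 le_ki.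
by rewrite nth_cat size_iter_sigma lt_i.
Qed.

Lemma thue_morse_fixpoint m n : 1 < m ->
  mkseq (thue_morse m) (m * n) = sigma (mkseq (thue_morse m) n).
Proof.
move=> m_gt1; have lt_n : n <= m ^ n by apply/ltnW/ltn_expl.
have take_mk (T : Type) (f : nat -> T) a b :
    a <= b -> mkseq f a = take a (mkseq f b).
  by move=> le_ab; rewrite /mkseq -map_take take_iota (minn_idPl le_ab).
rewrite (take_mk _ _ _ (m ^ n.+1)) ?expnS ?leq_mul2l ?lt_n ?orbT // -expnS.
rewrite thue_morse_prefix //= -thue_morse_prefix //.
rewrite -[in LHS](cat_take_drop n (mkseq _ (m ^ n))) -take_mk // sigma_cat.
by rewrite take_size_cat // size_sigma size_mkseq.
Qed.

(* Main.v *)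
Require Import Defs.
From mathcomp Require Import all_boot all_algebra.
From mathcomp Require Import boolp zify ring.

Import GRing.Theory.

(** Why the complexity is ultimately periodic.

    Write [sigma2] for the square of [sigma] and [t] for [thue_morse m].  Each
    image of a letter under [sigma] is a permutation of the alphabet.  Hence
    the number of occurrences of a word [ab] in [sigma2 u] depends on the
    length of [u] alone ([binom_word2_sigma2]): on words of a given length,
    [sigma2] is constant up to 2-binomial equivalence.

    Since [t] is fixed by [sigma2], its prefix of length [m ^ 2 * k + s] is
    [sigma2] of the prefix of length [k], followed by the first [s] letters of
    [sigma2 (t k)]. A factor [w] of length [n] is a difference of two such
    prefixes, so its class depends only on [n], on its starting position [i]
    modulo [m ^ 2], called [s], and on the two letters [x] and [y] whose
    [sigma2]-images cover the positions [i] and [i + n]. With [q = n %/ m ^ 2]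
    and [r = n %% m ^ 2], the counts of [w] are [m * q + C] for letters and
    ['C(m * q, 2) + A * q + B] for words of length two, where [(C, A, B)] is
    determined by [r], [s], [x], [y] ([profileE], [factor_profile]).

    There are finitely many [(r, s, x, y)], so the integers [B] are bounded.
    Once [q] exceeds twice the bound, [A * q + B = A' * q + B'] forces [A = A']
    and [B = B'] ([eq_affine_int]).  From then on two factors are equivalent
    exactly when their triples agree for all [a], [b], a condition in which
    [n] occurs only through [r].

    It remains that the same parameters [(s, x, y)] occur for all large [n].
    All of them do, because every pair of letters occurs in [t] at every
    positive distance ([thue_morse_pair]). The complexity at a large [n] is
    therefore the number of distinct profiles for [r]
    ([binom_complexity_thue_morse]), a function of [n] modulo [m ^ 2]. *)

(** * Counting subsequences of length at most two *)

Lemma binom_word_nil {T : eqType} (x : seq T) :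
  binom_word [::] x = (x == [::]).
Proof.
rewrite /binom_word; case: eqVneq => [->|xN].
  rewrite -[RHS](card_tuple 0 bool) -cardsT; apply: eq_card => s.
  by rewrite !inE tuple0.
by apply: eq_card0 => s; rewrite !inE tuple0 eq_sym (negPf xN).
Qed.

(** A mask either skips the first letter or keeps it; the latter case is left
    in raw form because its value depends on whether [x] is empty. *)
Lemma binom_word_cons {T : eqType} (c : T) (u x : seq T) :
  binom_word (c :: u) x =
    binom_word u x + #|[set s : (size u).-tuple bool | c :: mask s u == x]|.
Proof.
pose F b := [set s : (size u).-tuple bool | mask (b :: s) (c :: u) == x].
pose g b (s : (size u).-tuple bool) : (size (c :: u)).-tuple bool :=
  cons_tuple b s.
have gI b : injective (g b) by move=> s t /(congr1 val) [] /val_inj.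
have disj : [disjoint g false @: F false & g true @: F true].
  apply/pred0P => s; apply/negP => /andP[/imsetP[t _ ->]] /imsetP[t' _].
  by move/(congr1 val).
have <- : #|g false @: F false| = binom_word u x by rewrite card_imset.
have <- : #|g true @: F true| =
    #|[set s : (size u).-tuple bool | c :: mask s u == x]|.
  by rewrite card_imset.
rewrite -cardsUI (disjoint_setI0 disj) cards0 addn0.
apply: eq_card => s; rewrite !inE.
apply/idP/orP => [|[]/imsetP[t + ->]]; try by rewrite inE.
case/tupleP: s => -[] s s_x; [right | left]; apply/imsetP.
  by exists s; [rewrite inE | apply: val_inj].
by exists s; [rewrite inE | apply: val_inj].
Qed.

Lemma binom_word0 {T : eqType} (u : seq T) : binom_word u [::] = 1.
Proof.
elim: u => [|c u IHu]; first by rewrite binom_word_nil.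
by rewrite binom_word_cons IHu eq_card0 // => s; rewrite !inE.
Qed.

Lemma binom_word_cons_cons {T : eqType} (c a : T) (u x : seq T) :
  binom_word (c :: u) (a :: x) =
    binom_word u (a :: x) + (c == a) * binom_word u x.
Proof.
rewrite binom_word_cons; congr (_ + _); case: eqP => [->|neq_ca].
  by rewrite mul1n; apply: eq_card => s; rewrite !inE eqseq_cons eqxx.
by apply: eq_card0 => s; rewrite !inE eqseq_cons; case: eqP.
Qed.

Lemma binom_word1 {T : eqType} (u : seq T) (a : T) :
  binom_word u [:: a] = count_mem a u.
Proof.
elim: u => [|c u IHu]; first by rewrite binom_word_nil.
by rewrite binom_word_cons_cons IHu binom_word0 muln1 addnC.
Qed.

Lemma binom_word2_cat {T : eqType} (u v : seq T) (a b : T) :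
  binom_word (u ++ v) [:: a; b] =
    binom_word u [:: a; b] + count_mem a u * count_mem b v
      + binom_word v [:: a; b].
Proof.
elim: u => [|c u IHu]; first by rewrite binom_word_nil.
rewrite cat_cons !binom_word_cons_cons IHu !binom_word1 count_cat /=; lia.
Qed.

Lemma binom_equiv2P {T : eqType} (u v : seq T) :
  binom_equiv 2 u v <->
    forall a b, count_mem a u = count_mem a v /\
      binom_word u [:: a; b] = binom_word v [:: a; b].
Proof.
split=> [h a b | h [|a [|b []]] // _]; rewrite -?binom_word1 ?h //.
- by rewrite !binom_word0.
- by rewrite !binom_word1; case: (h a a).
- by case: (h a b).
Qed.

(** * Images under the morphism *)

Lemma perm_sigma_letter {m} (c : 'Z_m) : 1 < m ->
  perm_eq (sigma_letter c) (enum 'Z_m).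
Proof.
move=> m_gt1.
have sub : {subset enum 'Z_m <= sigma_letter c}.
  move=> a _; apply/mapP; exists (val (a - c)%R).
    by rewrite mem_iota (leq_trans (ltn_ord _)) // Zp_cast.
  by rewrite natr_Zp addrC subrK.
have szE : size (sigma_letter c) = size (enum 'Z_m).
  by rewrite size_map size_iota -cardE card_ord Zp_cast.
rewrite perm_sym uniq_perm ?enum_uniq //.
  by apply: leq_size_uniq (enum_uniq _) sub _; rewrite szE.
by case: (uniq_min_size (enum_uniq _) sub); rewrite ?szE.
Qed.

Lemma count_sigma_letter {m} (a c : 'Z_m) : 1 < m ->
  count_mem a (sigma_letter c) = 1.
Proof.
move=> m_gt1; rewrite (permP (perm_sigma_letter c m_gt1)).
by rewrite count_uniq_mem ?enum_uniq // mem_enum.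
Qed.

Lemma count_sigma {m} (a : 'Z_m) (u : seq 'Z_m) : 1 < m ->
  count_mem a (sigma u) = size u.
Proof.
move=> m_gt1; elim: u => // c u IHu.
by rewrite [sigma _]/= count_cat IHu count_sigma_letter.
Qed.

(** Two letters in different blocks contribute one occurrence of [ab] for each
    pair of blocks, since every block contains [a] once and [b] once. *)
Lemma binom_word2_sigma {m} (a b : 'Z_m) (u : seq 'Z_m) : 1 < m ->
  binom_word (sigma u) [:: a; b] =
    'C(size u, 2) + \sum_(c <- u) binom_word (sigma_letter c) [:: a; b].
Proof.
move=> m_gt1; elim: u => [|c u IHu]; first by rewrite binom_word_nil big_nil.
rewrite [sigma _]/= binom_word2_cat IHu count_sigma_letter // count_sigma //.
rewrite big_cons binS bin1 /=; ring.
Qed.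

(** The contribution of a single [sigma2]-block coming from pairs inside one
    [sigma]-block: the [m] inner blocks start with each letter once, in an
    order that does not matter. *)
Definition block_pairs {m} (a b : 'Z_m) : nat :=
  \sum_(c : 'Z_m) binom_word (sigma_letter c) [:: a; b].

Lemma binom_word2_sigma2 {m} (a b : 'Z_m) (u : seq 'Z_m) : 1 < m ->
  binom_word (sigma (sigma u)) [:: a; b] =
    'C(m * size u, 2) + size u * block_pairs a b.
Proof.
move=> m_gt1; rewrite binom_word2_sigma // size_sigma; congr (_ + _).
elim: u => [|c u IHu]; first by rewrite big_nil.
rewrite [sigma _]/= big_cat IHu mulSn; congr (_ + _).
by rewrite (perm_big _ (perm_sigma_letter c m_gt1)) big_enum.
Qed.

Lemma bin2D i j : 'C(i + j, 2) = 'C(i, 2) + 'C(j, 2) + i * j.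
Proof.
elim: i => [|i IHi]; first by rewrite addn0.
by rewrite addSn !binS !bin1 IHi; lia.
Qed.

(** The coefficients [(C, A, B)] of the counts of [a] and [ab], as functions
    of [q], in the word [w] with [sigma2 U ++ P ++ w = sigma2 V ++ Q] and
    [size V = size U + q + e]. The quadratic term ['C(m * q, 2)] is common to
    all words and is left out. *)
Definition profile {m} (P Q : seq 'Z_m) (e : nat) (ab : 'Z_m * 'Z_m) :
    int * int * int :=
  (let: (a, b) := ab in
   let p c := (count_mem c P)%:Z in let q c := (count_mem c Q)%:Z in
   let k := (block_pairs a b)%:Z in
   ((m * e)%:Z + q a - p a,
    (m ^ 2 * e)%:Z + k + m%:Z * (q b - p a),
    'C(m * e, 2)%:Z + k * e%:Z + (m * e)%:Z * (q b - p a)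
      + (binom_word Q [:: a; b])%:Z - (binom_word P [:: a; b])%:Z
      - p a * (q b - p b)))%R.

(** The counts of [w] follow by cancelling [sigma2 U ++ P] on the left:
    occurrences of [ab] in the whole word that are not inside [w] lie inside
    the cancelled prefix or have only their [b] in [w]. The size of [U]
    disappears from the result, so the absolute position of [w] is
    irrelevant. *)
Lemma profileE {m} (U V P Q w : seq 'Z_m) (q e : nat) (a b : 'Z_m) :
  1 < m ->
  sigma (sigma U) ++ P ++ w = sigma (sigma V) ++ Q ->
  size V = size U + (q + e) ->
  let: (C, A, B) := profile P Q e (a, b) in
  ((count_mem a w)%:Z = (m * q)%:Z + C /\
   (binom_word w [:: a; b])%:Z = 'C(m * q, 2)%:Z + A * q%:Z + B)%R.
Proof.
move=> m_gt1 E szV.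
have cE x : m * size U + (count_mem x P + count_mem x w) =
            m * size V + count_mem x Q.
  move/(congr1 (count_mem x)): E.
  by rewrite !count_cat !count_sigma // !size_sigma.
have ca := cE a; have cb := cE b.
move/(congr1 (fun u => binom_word u [:: a; b])): E.
rewrite !binom_word2_cat !count_cat !count_sigma // !size_sigma.
rewrite !binom_word2_sigma2 // szV !mulnDr !bin2D.
rewrite szV in ca cb.
rewrite /profile.
move: (count_mem a P) (count_mem b P) (count_mem a Q) (count_mem b Q)
  (count_mem a w) (count_mem b w) (binom_word w _) (binom_word P _)
  (binom_word Q _) (block_pairs _ _) (size U) ca cb
  => pa pb qa qb wa wb bw bP bQ k u ca cb E.
(* Isolating [wb] and [bw] makes the claim a polynomial identity. *)
have wbE : (wb%:Z = m%:Z * q%:Z + m%:Z * e%:Z + qb%:Z - pb%:Z)%R by lia.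
split; first by lia.
have bwE : (bw%:Z = ('C(m * q, 2) + 'C(m * e, 2))%:Z
   + (m * u * (m * q + m * e) + m * q * (m * e))%:Z + ((q + e) * k)%:Z
   + ((m * u + (m * q + m * e)) * qb)%:Z + bQ%:Z
   - (m * u * (pb + wb))%:Z - bP%:Z - (pa * wb)%:Z)%R by lia.
rewrite bwE !PoszD !PoszM !PoszD !PoszM wbE; ring.
Qed.

(** * The letters of the generalized Thue-Morse word *)

Lemma mkseqD {T : Type} (w : nat -> T) i n :
  mkseq w (i + n) = mkseq w i ++ mkseq (fun j => w (i + j)) n.
Proof. by rewrite /mkseq iotaD map_cat [0 + i]addnC iotaDl -map_comp. Qed.

Lemma factor_atE {T : Type} (w : nat -> T) n i :
  factor_at w n i = mkseq (fun j => w (i + j)) n :> seq T.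
Proof. by rewrite /mkseq -val_enum_ord -map_comp. Qed.

Lemma sigma_seq1 {m} (x : 'Z_m) : sigma [:: x] = sigma_letter x.
Proof. exact: cats0. Qed.

Lemma thue_morse_digit m k r : 1 < m -> r < m ->
  thue_morse m (m * k + r) = (thue_morse m k + r%:R)%R.
Proof.
move=> m_gt1 lt_rm.
have := thue_morse_fixpoint k.+1 m_gt1.
rewrite mkseqS -cats1 sigma_cat -thue_morse_fixpoint // => E.
have lt_r : m * k + r < m * k.+1 by rewrite mulnS addnC ltn_add2r.
rewrite -(nth_mkseq 0%R (thue_morse m) lt_r) E sigma_seq1 nth_cat size_mkseq.
rewrite ltnNge leq_addr /= addKn (nth_map 0) ?size_iota //.
by rewrite nth_iota.
Qed.

Lemma thue_morse0 m : thue_morse m 0 = 0%R.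
Proof. by []. Qed.

(** Additivity over base-[m] blocks: [thue_morse m k] is the sum modulo [m] of
    the base-[m] digits of [k]. *)
Lemma thue_morse_block m L k b : 1 < m -> b < m ^ L ->
  thue_morse m (m ^ L * k + b) = (thue_morse m k + thue_morse m b)%R.
Proof.
move=> m_gt1; have m_gt0 := ltnW m_gt1.
elim: L b => [|L IHL] b.
  by rewrite expn0 ltnS leqn0 => /eqP ->; rewrite mul1n addn0 addr0.
rewrite expnS => lt_b.
have lt_r : b %% m < m by rewrite ltn_mod.
have lt_q : b %/ m < m ^ L by rewrite ltn_divLR // mulnC.
rewrite {1 2}(divn_eq b m) [_ %/ _ * _]mulnC addnA -mulnA -mulnDr.
by rewrite !thue_morse_digit // IHL // addrA.
Qed.

(** The number [m ^ c - 1] has [c] digits, all equal to [m - 1]. *)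
Lemma thue_morse_repdigit m c : 1 < m ->
  (thue_morse m (m ^ c - 1) = - c%:R)%R.
Proof.
move=> m_gt1; have m_gt0 := ltnW m_gt1.
elim: c => [|c IHc]; first by rewrite subnn oppr0.
have -> : m ^ c.+1 - 1 = m * (m ^ c - 1) + (m - 1).
  have : 0 < m ^ c by rewrite expn_gt0 m_gt0.
  by rewrite expnS; move: (m ^ c); nia.
have m1 : ((m - 1)%:R = - 1 :> 'Z_m)%R.
  by rewrite natrB // pchar_Zp // sub0r.
by rewrite thue_morse_digit ?IHc ?m1 ?subn1 ?prednK // -opprD -natr1.
Qed.

(** Adding [d] to a number ending in the digits of [m ^ d - d] produces a
    carry, which propagates through a run of [c] digits [m - 1]. These digits
    disappear from the sum for [k + d] but contribute [- c] to the one for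
    [k], so the two letters can be prescribed independently: [y] by the
    leading digits, then [x] by [c]. *)
Lemma thue_morse_pair m d (x y : 'Z_m) : 1 < m -> 0 < d ->
  exists k, thue_morse m k = x /\ thue_morse m (k + d) = y.
Proof.
move=> m_gt1 d_gt0; have m_gt0 := ltnW m_gt1.
have lt_d : d < m ^ d by apply: ltn_expl.
have lt_y : (y - 1)%R < m by apply: leq_trans (ltn_ord _) _; rewrite Zp_cast.
(* The leading part of [k + d]: a positive number with digit sum [y] modulo
   [m]; writing it with two digits avoids the number 0 when [y] is 0. *)
pose E := m * 1 + (y - 1)%R.
have tE : thue_morse m E = y.
  rewrite thue_morse_digit // natr_Zp -[1]/(0 + 1) -[X in X + 1](muln0 m).
  by rewrite thue_morse_digit // thue_morse0 add0r addrC subrK.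
have E_gt0 : 0 < E by rewrite /E; lia.
pose b := m ^ d - d.
pose c : 'Z_m := (thue_morse m E.-1 + thue_morse m b - x)%R.
have mc_gt0 : 0 < m ^ c by rewrite expn_gt0 m_gt0.
have lt_mc : m ^ c - 1 < m ^ c by rewrite subn1 prednK.
exists (m ^ d * (m ^ c * E.-1 + (m ^ c - 1)) + b); split.
  rewrite thue_morse_block /b ?ltn_subrL ?d_gt0 ?expn_gt0 ?m_gt0 //.
  rewrite thue_morse_block ?lt_mc // thue_morse_repdigit //.
  by rewrite natr_Zp /c; ring.
have -> : m ^ d * (m ^ c * E.-1 + (m ^ c - 1)) + b + d
          = m ^ d * (m ^ c * E + 0) + 0.
  rewrite /b -addnA subnK ?(ltnW lt_d) // -mulnSr !addn0; congr (_ * _).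
  by rewrite -addnS subn1 prednK // -mulnSr prednK.
by rewrite !thue_morse_block ?expn_gt0 ?m_gt0 // thue_morse0 !addr0.
Qed.

(** * Classes of factors *)

(** Classes of [D] may be counted on a family of representatives: [f @^-1: _]
    is a bijection between the two sets of classes. *)
Lemma card_partition_pullback {T I : finType} (R : rel T) (D : {set T})
    (f : I -> T) :
  equivalence_rel R ->
  (forall i, f i \in D) -> (forall u, u \in D -> exists i, R u (f i)) ->
  #|equivalence_partition R D| =
    #|equivalence_partition (relpre f R) [set: I]|.
Proof.
move=> eqR fD f_onto.
have Rl x y : R x y -> R x =1 R y.
  by move=> xy z; case: (eqR x y z) => _ /(_ xy).
pose g (A : {set T}) := f @^-1: A.
rewrite -[LHS](@card_in_imset _ _ g)
  => [|A B /imsetP[x xD ->] /imsetP[y yD ->]].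
  apply: eq_card => A; apply/imsetP/imsetP
    => [[_ /imsetP[u uD ->] ->] | [i _ ->]].
    have [i ui] := f_onto u uD; exists i => //.
    by apply/setP => j; rewrite !inE fD /= (Rl _ _ ui).
  exists [set y in D | R (f i) y]; first by apply/imsetP; exists (f i).
  by apply/setP => j; rewrite !inE fD.
have [i xi] := f_onto x xD; move/setP/(_ i); rewrite !inE fD xi /= => /esym yi.
by apply/setP => z; rewrite !inE (Rl _ _ xi) (Rl _ _ yi).
Qed.

(** A prefix of [t] of length [m ^ 2 * k + s] cuts the block [sigma2 (t k)]
    after this word. *)
Definition cut {m} (x : 'Z_m) (s : nat) : seq 'Z_m :=
  take s (sigma (sigma [:: x])).

Lemma thue_morse_cut m k s : 1 < m -> s <= m ^ 2 ->
  mkseq (thue_morse m) (m ^ 2 * k + s)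
    = sigma (sigma (mkseq (thue_morse m) k)) ++ cut (thue_morse m k) s.
Proof.
move=> m_gt1 le_s; rewrite mkseqD -mulnn -mulnA !thue_morse_fixpoint //.
congr (_ ++ _).
have : mkseq (thue_morse m) (m * (m * k.+1))
       = sigma (sigma (mkseq (thue_morse m) k))
           ++ sigma (sigma [:: thue_morse m k]).
  by rewrite !thue_morse_fixpoint // mkseqS -cats1 !sigma_cat.
have -> : m * (m * k.+1) = m * (m * k) + (s + (m ^ 2 - s)).
  by rewrite subnKC // !mulnS mulnDr addnC.
rewrite mkseqD mkseqD !thue_morse_fixpoint // => /eqP.
rewrite eqseq_cat // eqxx /= => /eqP E.
by rewrite /cut -E take_size_cat ?size_mkseq // mulnA.
Qed.

Definition cut_profile {m} (r : nat) (p : 'I_(m ^ 2) * 'Z_m * 'Z_m) :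
    {ffun 'Z_m * 'Z_m -> int * int * int} :=
  let: (s, x, y) := p in
  [ffun ab => profile (cut x s) (cut y ((s + r) %% m ^ 2))
                      ((s + r) %/ m ^ 2) ab].

(** A factor starting at [m ^ 2 * k + s] ends at [s + n] positions after
    [m ^ 2 * k]; the quotient of [s + n] by [m ^ 2] is [q] plus the carry
    [(s + r) %/ m ^ 2]. *)
Lemma factor_profile {m} n k (p : 'I_(m ^ 2) * 'Z_m * 'Z_m)
    (a b : 'Z_m) : 1 < m ->
  thue_morse m k = p.1.2 -> thue_morse m (k + (p.1.1 + n) %/ m ^ 2) = p.2 ->
  let w := factor_at (thue_morse m) n (m ^ 2 * k + p.1.1) in
  let q := n %/ m ^ 2 in
  let: (C, A, B) := cut_profile (n %% m ^ 2) p (a, b) in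
  ((count_mem a w)%:Z = (m * q)%:Z + C /\
   (binom_word w [:: a; b])%:Z = 'C(m * q, 2)%:Z + A * q%:Z + B)%R.
Proof.
case: p => [[s x] y] m_gt1 tx ty w q; simpl in tx, ty; subst x y.
rewrite ffunE.
have m2_gt0 : 0 < m ^ 2 by rewrite expn_gt0 ltnW.
have dE : (s + n) %/ m ^ 2 = q + (s + n %% m ^ 2) %/ m ^ 2.
  by rewrite {1}(divn_eq n (m ^ 2)) addnCA divnMDl.
apply: (@profileE m (mkseq (thue_morse m) k)
          (mkseq (thue_morse m) (k + (s + n) %/ m ^ 2))) => //.
  have lt_t : (s + n) %% m ^ 2 <= m ^ 2 by rewrite ltnW ?ltn_mod.
  rewrite modnDmr -(thue_morse_cut m _ _ m_gt1 lt_t).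
  rewrite factor_atE catA -(thue_morse_cut m _ _ m_gt1 (ltnW (ltn_ord s))).
  rewrite -mkseqD; congr mkseq.
  by rewrite mulnDr -!addnA [m ^ 2 * (_ %/ _)]mulnC -divn_eq.
by rewrite !size_mkseq dE.
Qed.

(** Distinct slopes differ by at least 1, so the linear terms are at least [q]
    apart, more than [B] and [B'] can compensate. *)
Lemma eq_affine_int (A B A' B' : int) (q : nat) : `|B| + `|B'| < q ->
  (A * q%:Z + B = A' * q%:Z + B')%R -> A = A' /\ B = B'.
Proof.
move=> lt_q E; have [AA' | neq] : A = A' \/ A <> A' by lia.
  by split=> //; rewrite AA' in E; lia.
exfalso; have [lt | lt] : (A + 1 <= A' \/ A' + 1 <= A)%R by lia.
  by nia.
by nia.
Qed.

(** The threshold makes [q] exceed twice the largest [B]; each parameter is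
    represented by one factor, chosen by [thue_morse_pair]. *)
Lemma binom_complexity_thue_morse m : 1 < m ->
  exists N, forall n, N <= n ->
    binom_complexity (thue_morse m) 2 n =
      #|preim_partition (@cut_profile m (n %% m ^ 2)) [set: _]|.
Proof.
move=> m_gt1; have m2_gt0 : 0 < m ^ 2 by rewrite expn_gt0 ltnW.
pose I := ('I_(m ^ 2) * 'Z_m * 'Z_m)%type.
pose h (z : 'I_(m ^ 2) * I * ('Z_m * 'Z_m)) :=
  `|(cut_profile z.1.1 z.1.2 z.2).2|.
pose M := \max_z h z.
have M_ge r (p : I) ab : r < m ^ 2 -> `|(cut_profile r p ab).2| <= M.
  by move=> lt_r; apply: (@leq_bigmax _ h (Ordinal lt_r, p, ab)).
exists (m ^ 2 * (M + M).+1) => n le_n.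
have q_gt : M + M < n %/ m ^ 2 by rewrite leq_divRL // mulnC.
have r_lt : n %% m ^ 2 < m ^ 2 by rewrite ltn_mod.
have start_ex (p : I) : exists k, thue_morse m k = p.1.2 /\
    thue_morse m (k + (p.1.1 + n) %/ m ^ 2) = p.2.
  apply: thue_morse_pair => //; rewrite divn_gt0 //.
  by apply: leq_trans (leq_addl _ _); apply: leq_trans le_n; rewrite leq_pmulr.
have [k kP] := boolp.choice start_ex.
pose f (p : I) := factor_at (thue_morse m) n (m ^ 2 * k p + p.1.1).
pose R := fun u v : n.-tuple 'Z_m => `[< binom_equiv 2 u v >].
have RE (u v : n.-tuple 'Z_m) :
    reflect (forall a b, count_mem a u = count_mem a v /\
      binom_word u [:: a; b] = binom_word v [:: a; b]) (R u v).
  by apply: (iffP (asboolP _)) => /binom_equiv2P.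
have eqR : equivalence_rel R.
  move=> u v w; split=> [|/RE uv]; first by apply/RE.
  by apply/RE/RE => h' a b; case: (uv a b) (h' a b) => -> -> [-> ->].
have fE (p p' : I) a b :
    (count_mem a (f p) = count_mem a (f p') /\
     binom_word (f p) [:: a; b] = binom_word (f p') [:: a; b]) <->
    cut_profile (n %% m ^ 2) p (a, b) = cut_profile (n %% m ^ 2) p' (a, b).
  have [kp kp'] := (kP p, kP p').
  have := factor_profile n _ p a b m_gt1 kp.1 kp.2.
  have := factor_profile n _ p' a b m_gt1 kp'.1 kp'.2.
  have := M_ge _ p' (a, b) r_lt; have := M_ge _ p (a, b) r_lt.
  rewrite -/(f p) -/(f p').
  case: (cut_profile _ p _) (cut_profile _ p' _) => [[C A] B] [[C' A'] B'] /=.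
  move=> Bp Bp' [c' w'] [c w]; split=> [[cE wE] | [CC AA BB]].
    rewrite -cE c in c'; rewrite -wE w in w'.
    have lt_q : `|B| + `|B'| < n %/ m ^ 2.
      by apply: leq_ltn_trans q_gt; apply: leq_add.
    have [-> ->] : A = A' /\ B = B' by apply: eq_affine_int lt_q _; lia.
    by congr (_, _, _); lia.
  by split; lia.
rewrite /binom_complexity -/R (@card_partition_pullback _ _ R _ f eqR).
- congr #|pred_of_set _|; apply: eq_imset => p /=; apply/setP => p'.
  rewrite !inE /=; apply/RE/eqP => [E | E a b]; last by apply/fE; rewrite E.
  by apply/ffunP => -[a b]; apply/fE.
- by move=> p; rewrite inE; apply/asboolP; exists (m ^ 2 * k p + p.1.1).
move=> u; rewrite inE => /asboolP[i ->].
have i_lt : i %% m ^ 2 < m ^ 2 by rewrite ltn_mod.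
pose p : I := (Ordinal i_lt, thue_morse m (i %/ m ^ 2),
  thue_morse m (i %/ m ^ 2 + (i %% m ^ 2 + n) %/ m ^ 2)).
exists p; apply/RE => a b.
have [kp1 kp2] := kP p.
have := factor_profile n _ p a b m_gt1 kp1 kp2.
have := factor_profile n (i %/ m ^ 2) p a b m_gt1 erefl erefl.
rewrite -/(f p) [m ^ 2 * (i %/ _)]mulnC -divn_eq.
case: (cut_profile _ p _) => [[C A] B] [c w] [c' w'].
by rewrite -c' in c; rewrite -w' in w; case: c w => -> [->].
Qed.

Theorem corollary1 (m : nat) (hm : 3 <= m) :
  exists N : nat, forall n : nat, N <= n ->
    binom_complexity (thue_morse m) 2 (n + m ^ 2)
      = binom_complexity (thue_morse m) 2 n.
Proof.
have [N bE] := binom_complexity_thue_morse m (ltnW hm).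
exists N => n le_n; rewrite !bE ?modnDr //.
by apply: leq_trans le_n (leq_addr _ _).
Qed.
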